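(* (a) Each hyperbolic or loxodromic Möbius transformation is topologically conjugate to $z\mapsto 2z$. (b) Each elliptic Möbius transformation is topologically conjugate to a transformation $z\mapsto \mu z$ with $\mu\in\mathbb C$, $|\mu|=1$, which is uniquely determined up to replacement of $\mu$ by $\bar\mu$. (c) Each parabolic Möbius transformation is topologically conjugate to $z\mapsto z+1$.
   Context: $\hat{\mathbb C}=\mathbb C\cup\{\infty\}$ is the extended complex plane (Riemann sphere). A Möbius transformation is a map $f:\hat{\mathbb C}\to\hat{\mathbb C}$ of the form $f(z)=\frac{az+b}{cz+d}$ with $a,b,c,d\in\mathbb C$, $ad-bc\neq 0$. Two Möbius transformations $f,g$ are conjugate if $g=h^{-1}fh$ for some Möbius transformation $h$; they are topologically conjugate if $g=h^{-1}fh$ for some homeomorphism $h:\hat{\mathbb C}\to\hat{\mathbb C}$. A nonidentity Möbius transformation is called - hyperbolic if it is conjugate to $z\mapsto\mu z$ with $\mu\in\mathbb R$, $\mu\ne 0$, $|\mu|\neq 1$; - loxodromic if it is conjugate to $z\mapsto \mu z$ with $\mu\in\mathbb C\setminus\mathbb R$ and $|\mu|\ne 1$; - elliptic if it is conjugate to $z\mapsto\mu z$ with $|\mu|=1$ and $\mu\ne 1$; - parabolic if it is conjugate to $z\mapsto z+1$. *)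

(* Defs.v *)
From HB Require Import structures.
From mathcomp Require Import all_boot all_order all_algebra.
From mathcomp Require Import complex.
From mathcomp Require Import all_classical all_reals.
From mathcomp Require Import topology normedtype.

Set Implicit Arguments.
Unset Strict Implicit.
Unset Printing Implicit Defensive.

Import Order.TTheory GRing.Theory Num.Theory.
Import numFieldNormedType.Exports.

Local Open Scope classical_set_scope.
Local Open Scope ring_scope.
Local Open Scope complex_scope.

(* The point at infinity is [None]; [R[i]^o] is [R[i]] with the topology of its
   modulus. *)
Definition sphere (R : realType) : topologicalType :=
  one_point_compactification (R[i]^o).

(* The usual conventions: a pole is sent to infinity, and infinity is sent to
   a / c (to infinity when c = 0). *)
Definition mobius (R : realType) (a b c d : R[i]) (z : sphere R) : sphere R :=
  match z with
  | Some z => if c * z + d == 0 then None else Some ((a * z + b) / (c * z + d))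
  | None => if c == 0 then None else Some (a / c)
  end.

Definition is_mobius (R : realType) (f : sphere R -> sphere R) : Prop :=
  exists a b c d : R[i], a * d - b * c != 0 /\ f = mobius a b c d.

Definition homeomorphism (T U : topologicalType) (h : T -> U) : Prop :=
  exists k : U -> T,
    [/\ cancel h k, cancel k h, continuous h & continuous k].

(* g = h^-1 f h for some bijection h in the class P, with k = h^-1. *)
Definition conjugate_by (T : Type) (P : (T -> T) -> Prop) (f g : T -> T) :
    Prop :=
  exists h k : T -> T,
    [/\ P h, cancel h k, cancel k h & g = k \o f \o h].

Definition conjugate (R : realType) (f g : sphere R -> sphere R) : Prop :=
  conjugate_by (@is_mobius R) f g.

Definition top_conjugate (R : realType) (f g : sphere R -> sphere R) : Prop :=
  conjugate_by (@homeomorphism (sphere R) (sphere R)) f g.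

Definition dilation (R : realType) (mu : R[i]) : sphere R -> sphere R :=
  mobius mu 0 0 1.

Definition unit_translation (R : realType) : sphere R -> sphere R :=
  mobius 1 1 0 1.

Definition nonid_mobius (R : realType) (f : sphere R -> sphere R) : Prop :=
  is_mobius f /\ f <> id.

Definition hyperbolic (R : realType) (f : sphere R -> sphere R) : Prop :=
  nonid_mobius f /\
  exists mu : R[i],
    [/\ mu \is Num.real, mu != 0, `|mu| != 1 & conjugate f (dilation mu)].

Definition loxodromic (R : realType) (f : sphere R -> sphere R) : Prop :=
  nonid_mobius f /\
  exists mu : R[i],
    [/\ mu \isn't Num.real, `|mu| != 1 & conjugate f (dilation mu)].

Definition elliptic (R : realType) (f : sphere R -> sphere R) : Prop :=
  nonid_mobius f /\
  exists mu : R[i],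
    [/\ `|mu| = 1, mu != 1 & conjugate f (dilation mu)].

Definition parabolic (R : realType) (f : sphere R -> sphere R) : Prop :=
  nonid_mobius f /\ conjugate f (@unit_translation R).

(* Main.v *)
(* Moebius maps are homeomorphisms of the sphere, so the three parts reduce to
   the normal forms.  For (a), z |-> z |z|^(s-1) e^(i t log |z|) is a
   multiplicative homeomorphism of the plane and sends 2 to any prescribed mu
   with |mu| > 1 for suitable s > 0 and t.  For the uniqueness in (b), a
   homeomorphism h conjugating two nontrivial rotations may be assumed to fix 0
   and infinity; it then lifts through the exponential to a map H of the plane
   with H(z + 2 pi i) = H(z) + 2 pi i d, and lifting the inverse of h as well
   shows d = 1 or d = -1.  If mu = e^(i theta) and nu = e^(i phi), then
   H(z + i theta) = H(z) + i phi for a suitable choice of phi, and comparing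
   the growth of H along the imaginary axis under both translations gives
   phi = d theta. *)
Require Import Defs.
From mathcomp Require Import all_boot all_order all_algebra.
From mathcomp Require Import complex.
From mathcomp Require Import all_classical all_reals.
From mathcomp Require Import topology normedtype.
From mathcomp Require Import sequences derive exp trigo.
From mathcomp Require Import ring lra.

Set Implicit Arguments.
Unset Strict Implicit.
Unset Printing Implicit Defensive.

Import Order.TTheory GRing.Theory Num.Theory.
Import numFieldNormedType.Exports.

Local Open Scope classical_set_scope.
Local Open Scope ring_scope.
Local Open Scope complex_scope.

Local Notation Re := (@complex.Re _).
Local Notation Im := (@complex.Im _).

(** * Complex moduli and the topology of the complex plane *)

Section complex_topology.
Context {R : realType}.
Implicit Types (z w : R[i]) (x y : R).

(* MathComp's [`|z|] is itself an element of [R[i]]. *)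
Definition modulus z : R := Re `|z|.

Lemma modulusE z : (modulus z)%:C = `|z|.
Proof. by rewrite /modulus normc_def. Qed.

Lemma normCE z : `|z| = (modulus z)%:C.
Proof. by rewrite modulusE. Qed.

Lemma modulus_ge0 z : 0 <= modulus z.
Proof. by rewrite -ler0c modulusE. Qed.

Lemma modulus_gt0 z : (0 < modulus z) = (z != 0).
Proof. by rewrite -ltcR modulusE normr_gt0. Qed.

Lemma modulusM z w : modulus (z * w) = modulus z * modulus w.
Proof. by apply: complexI; rewrite rmorphM !modulusE normrM. Qed.

Lemma modulusV z : modulus z^-1 = (modulus z)^-1.
Proof. by apply: complexI; rewrite fmorphV !modulusE normfV. Qed.

Lemma modulusN z : modulus (- z) = modulus z.
Proof. by rewrite /modulus normrN. Qed.

Lemma sqr_modulus z : modulus z ^+ 2 = Re z ^+ 2 + Im z ^+ 2.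
Proof.
by rewrite /modulus normc_def /= sqr_sqrtr// addr_ge0// sqr_ge0.
Qed.

Lemma modulusR x : modulus x%:C = `|x|.
Proof. by rewrite /modulus normc_def /= expr0n addr0 sqrtr_sqr. Qed.

Lemma Re_le_modulus z : `|Re z| <= modulus z.
Proof. by rewrite -lecR modulusE normc_ge_Re. Qed.

Lemma Im_le_modulus z : `|Im z| <= modulus z.
Proof.
rewrite -(ler_pXn2r (n := 2))// ?nnegrE ?modulus_ge0// sqr_modulus.
by rewrite real_normK ?num_real// lerDr sqr_ge0.
Qed.

Lemma modulus_le_ReIm z : modulus z <= `|Re z| + `|Im z|.
Proof.
rewrite -(ler_pXn2r (n := 2))// ?nnegrE ?modulus_ge0 ?addr_ge0//.
rewrite sqr_modulus sqrrD !real_normK ?num_real//.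
by rewrite lerD2r lerDl mulrn_wge0// mulr_ge0.
Qed.

(** The normed-space criterion quantifies over positive radii in [R[i]]. A positive element of
    [R[i]] is real, so radii in [R] suffice. *)
Lemma cvgC_lt (T : Type) (F : set_system T) (FF : Filter F) (f : T -> R[i]^o)
    (l : R[i]^o) :
  f @ F --> l <-> forall e : R, 0 < e -> \forall t \near F, modulus (l - f t) < e.
Proof.
rewrite cvgrPdist_lt; split => h e e0.
  have := h e%:C; rewrite ltcR => /(_ e0); apply: filterS => t.
  by rewrite -(modulusE (l - f t)) ltcR.
have eE : e = (Re e)%:C by rewrite RRe_real// gtr0_real.
have /h : 0 < Re e by rewrite -ltcR -eE.
by apply: filterS => t; rewrite -ltcR -eE modulusE.
Qed.

(* Restated at [R[i]^o] because unification otherwise unfolds the neighborhood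
   filters of [R[i]^o]. *)
Lemma cvgC_add (T : Type) (F : set_system T) (FF : Filter F)
    (f g : T -> R[i]^o) (a b : R[i]^o) :
  f @ F --> a -> g @ F --> b -> (f t + g t : R[i]^o) @[t --> F] --> (a + b : R[i]^o).
Proof. exact: cvgD. Qed.

Lemma cvgC_mul (T : Type) (F : set_system T) (FF : Filter F)
    (f g : T -> R[i]^o) (a b : R[i]^o) :
  f @ F --> a -> g @ F --> b -> (f t * g t : R[i]^o) @[t --> F] --> (a * b : R[i]^o).
Proof. exact: cvgM. Qed.

Lemma cvgC_inv (T : Type) (F : set_system T) (FF : Filter F)
    (f : T -> R[i]^o) (a : R[i]^o) : a != 0 ->
  f @ F --> a -> ((f t)^-1 : R[i]^o) @[t --> F] --> (a^-1 : R[i]^o).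
Proof. exact: cvgV. Qed.

Lemma cvg_Re (T : Type) (F : set_system T) (FF : Filter F) (f : T -> R[i]^o)
    (l : R[i]^o) :
  f @ F --> l -> (Re (f t) : R) @[t --> F] --> (Re l : R).
Proof.
move=> /cvgC_lt fl; apply/cvgrPdist_lt => e e0.
have := fl _ e0; apply: filterS => t; apply: le_lt_trans.
have -> : Re l - Re (f t) = Re (l - f t) by case: (l) (f t) => ? ? [].
exact: Re_le_modulus.
Qed.

Lemma cvg_Im (T : Type) (F : set_system T) (FF : Filter F) (f : T -> R[i]^o)
    (l : R[i]^o) :
  f @ F --> l -> (Im (f t) : R) @[t --> F] --> (Im l : R).
Proof.
move=> /cvgC_lt fl; apply/cvgrPdist_lt => e e0.
have := fl _ e0; apply: filterS => t; apply: le_lt_trans.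
have -> : Im l - Im (f t) = Im (l - f t) by case: (l) (f t) => ? ? [].
exact: Im_le_modulus.
Qed.

Lemma cvg_Complex (T : Type) (F : set_system T) (FF : Filter F) (f g : T -> R)
    (a b : R) :
  f @ F --> a -> g @ F --> b ->
  (fun t => (f t +i* g t : R[i]^o)) @ F --> (a +i* b : R[i]^o).
Proof.
move=> /cvgrPdist_lt fa /cvgrPdist_lt gb; apply/cvgC_lt => e e0.
have e20 : 0 < e / 2 by rewrite divr_gt0.
near=> t; apply: le_lt_trans (modulus_le_ReIm _) _ => /=.
rewrite [ltRHS](splitr e) ltrD//.
- by near: t; exact: fa.
- by near: t; exact: gb.
Unshelve. all: by end_near. Qed.

Lemma cvg_conj (T : Type) (F : set_system T) (FF : Filter F) (f : T -> R[i]^o)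
    (l : R[i]^o) :
  f @ F --> l -> ((f t)^* : R[i]^o) @[t --> F] --> (l^* : R[i]^o).
Proof.
move=> fl; have conjE (z : R[i]) : z^* = Re z +i* - Im z by case: z.
rewrite conjE; under eq_fun do rewrite conjE.
by apply: cvg_Complex; [exact: cvg_Re|apply: cvgN; exact: cvg_Im].
Qed.

Lemma cvg_modulus (T : Type) (F : set_system T) (FF : Filter F) (f : T -> R[i]^o)
    (l : R[i]^o) :
  f @ F --> l -> modulus (f t) @[t --> F] --> modulus l.
Proof. by move=> fl; exact: (@cvg_Re _ F FF (fun t => `|f t|) _ (cvg_norm fl)). Qed.

Lemma continuous_modulus : continuous (fun z : R[i]^o => modulus z).
Proof. by move=> z; exact: (@cvg_modulus _ _ (nbhs_filter z) id z). Qed.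

(** The disc is closed and lies in the continuous image of the compact square [-M, M]^2. *)
Lemma modulus_le_compact (M : R) : compact [set z : R[i]^o | modulus z <= M].
Proof.
pose f (p : R * R) : R[i]^o := p.1 +i* p.2.
have cf : continuous f.
  by move=> p; apply: cvg_Complex; [exact: cvg_fst|exact: cvg_snd].
apply: (@subclosed_compact _ _ (f @` (`[- M, M] `*` `[- M, M]))).
- rewrite (_ : [set _ | _] = (fun z : R[i]^o => modulus z) @^-1` [set x | x <= M]) //.
  apply: closed_comp; last exact: closed_le.
  by move=> z _; exact: continuous_modulus.
- apply: continuous_compact; first exact: continuous_subspaceT.
  by apply: compact_setX; exact: segment_compact.
- move=> z /= zM; exists (Re z, Im z); last by case: z {zM}.
  split => /=; rewrite in_itv/= -ler_norml.
  - exact: le_trans (Re_le_modulus z) zM.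
  - exact: le_trans (Im_le_modulus z) zM.
Qed.

Lemma compact_modulus_bounded (K : set R[i]^o) :
  compact K -> exists M : R, forall z, K z -> modulus z <= M.
Proof.
move=> cK.
have : compact ((fun z : R[i]^o => modulus z) @` K).
  apply: continuous_compact => //; apply: continuous_subspaceT.
  exact: continuous_modulus.
(* Boundedness is only granted for numbers strictly above [M], hence the [+ 1]. *)
move=> /compact_bounded[M [_ hM]]; exists (M + 1) => z Kz.
have := hM (M + 1); rewrite ltrDl ltr01 => /(_ isT (modulus z)) /=.
by rewrite ger0_norm ?modulus_ge0//; apply; exists z.
Qed.

End complex_topology.

(** * Homeomorphisms of the sphere *)

Section sphere_maps.
Context {R : realType}.
Local Notation C := (R[i]^o).

Lemma homeomorphism_comp (T U V : topologicalType) (f : T -> U) (g : U -> V) :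
  homeomorphism f -> homeomorphism g -> homeomorphism (g \o f).
Proof.
move=> [f' [fK f'K cf cf']] [g' [gK g'K cg cg']]; exists (f' \o g'); split.
- exact: can_comp.
- exact: can_comp.
- by move=> x; apply: continuous_comp; [exact: cf|exact: cg].
- by move=> x; apply: continuous_comp; [exact: cg'|exact: cf'].
Qed.

(** This intertwining form, which leaves the inverse of [h] implicit, is how the explicit
    conjugacies below are established. *)
Lemma top_conjugate_of (f g h : sphere R -> sphere R) :
  homeomorphism h -> f \o h = h \o g -> top_conjugate f g.
Proof.
move=> [k [hK kH ch ck]] fh; exists h, k; split => //; first by exists k.
by rewrite -compA fh; apply/funext => z /=; rewrite hK.
Qed.

Lemma top_conjugate_trans (f g e : sphere R -> sphere R) :
  top_conjugate f g -> top_conjugate g e -> top_conjugate f e.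
Proof.
move=> [h [k [Hh hK kK ->]]] [h' [k' [Hh' hK' kK' ->]]].
apply: (@top_conjugate_of _ _ (h \o h')); first exact: homeomorphism_comp.
by apply/funext => z /=; rewrite kK' kK.
Qed.

Lemma top_conjugate_sym (f g : sphere R -> sphere R) :
  top_conjugate f g -> top_conjugate g f.
Proof.
move=> [h [k [[k' [hK' kK' ch ck']] hK kK ->]]].
(* The inverse in the conjugacy and the continuous inverse are separate witnesses. They coincide,
   which makes [k] continuous. *)
have kE : k = k' by apply/funext => z; rewrite -[LHS]hK' kK.
apply: (@top_conjugate_of _ _ k).
  by exists h; split => //; rewrite kE.
by apply/funext => z /=; rewrite kK.
Qed.

Lemma nbhs_CP (z : C) (A : set C) :
  nbhs z A <-> exists2 e : R, 0 < e & forall w, modulus (z - w) < e -> A w.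
Proof.
apply: (iff_trans (@nbhs_normP _ C z A)).
split=> [[e /= e0 eA]|[e e0 eA]].
  have eE : e = (Re e)%:C by rewrite RRe_real// gtr0_real.
  exists (Re e) => [|w we]; first by rewrite -ltcR -eE.
  by apply: eA; rewrite /= normCE eE ltcR.
exists e%:C; first by rewrite /= ltcR.
by move=> w /=; rewrite normCE ltcR; exact: eA.
Qed.

(** Neighborhoods of infinity contain the complement of a closed compact set. Compact sets are
    bounded, and closed discs are compact and closed. *)
Lemma nbhs_sphere_None (A : set (sphere R)) :
  nbhs (None : sphere R) A <->
  A None /\ exists M : R, forall z, M < modulus z -> A (Some z).
Proof.
split=> [[K [cK _] KA]|[A0 [M MA]]].
  split; first by apply: KA; right.
  have [M MK] := compact_modulus_bounded cK; exists M => z Mz.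
  by apply: KA; left; exists z => // /MK; rewrite leNgt Mz.
exists [set z : C | modulus z <= M]; last first.
  move=> _ [[z /= /negP + <-]|->//]; rewrite -ltNge; exact: MA.
have cM : compact [set z : C | modulus z <= M] by exact: modulus_le_compact.
split => //.
by apply: compact_closed => //; exact: norm_hausdorff.
Qed.

(** Continuity at infinity is properness: if [u z] stays in a disc, then z lies in the image of that
    disc under the continuous inverse [v], which is compact and so bounded. *)
Lemma homeomorphism_omap (f g : C -> C) :
  cancel f g -> cancel g f -> continuous f -> continuous g ->
  homeomorphism (omap f : sphere R -> sphere R).
Proof.
have coo (u v : C -> C) : cancel u v -> continuous u -> continuous v ->
    continuous (omap u : sphere R -> sphere R).
  move=> uK cu cv [z|] A.
    by move=> /= /cu.
  move=> /nbhs_sphere_None[A0 [M MA]]; apply/nbhs_sphere_None; split => //.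
  have : compact (v @` [set z : C | modulus z <= M]).
    apply: continuous_compact; first exact: continuous_subspaceT.
    exact: modulus_le_compact.
  move=> /compact_modulus_bounded[N MN]; exists N => z Nz; apply: MA.
  rewrite ltNge; apply/negP => uzM.
  by move: Nz; rewrite ltNge MN//; exists (u z).
move=> fK gK cf cg; exists (omap g); split.
- by case=> //= z; rewrite fK.
- by case=> //= z; rewrite gK.
- exact: coo fK cf cg.
- exact: coo gK cg cf.
Qed.

Lemma homeomorphism_affine (a b : R[i]) : a != 0 ->
  homeomorphism (omap (fun z : C => a * z + b : C) : sphere R -> sphere R).
Proof.
move=> a0.
have cl (c d : C) : continuous (fun z : C => c * z + d : C).
  move=> z; apply: (cvgC_add (nbhs_filter z)); last exact: cvg_cst.
  by apply: (cvgC_mul (nbhs_filter z)); [exact: cvg_cst|exact: cvg_id].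
apply: (@homeomorphism_omap _ (fun z => a^-1 * z + (- (a^-1 * b)))).
- by move=> z /=; field.
- by move=> z /=; field.
- exact: cl.
- exact: cl.
Qed.

Definition sphere_inv (z : sphere R) : sphere R :=
  match z with
  | Some z => if z == 0 then None else Some z^-1
  | None => Some 0
  end.

Lemma sphere_invK : involutive sphere_inv.
Proof.
case=> [z|] /=; last by rewrite eqxx.
by case: eqVneq => [->//|z0] /=; rewrite invr_eq0 (negPf z0) invrK.
Qed.

Lemma homeomorphism_inv : homeomorphism sphere_inv.
Proof.
suff ci : continuous sphere_inv.
  by exists sphere_inv; split => //; exact: sphere_invK.
case=> [z|] A /=; last first.
  move=> /nbhs_CP[e e0 eA]; apply/nbhs_sphere_None; split.
    by apply: eA; rewrite subr0 modulusR normr0.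
  exists e^-1 => z ez; have z0 : z != 0.
    by rewrite -modulus_gt0 (lt_trans _ ez)// invr_gt0.
  rewrite /= (negPf z0); apply: eA.
  by rewrite sub0r modulusN modulusV invf_plt// ?posrE ?modulus_gt0.
have [->|z0] := eqVneq z 0.
  move=> /nbhs_sphere_None[A0 [M MA]]; apply/nbhs_CP.
  (* [M] may be nonpositive; the maximum with 1 keeps the radius positive. *)
  exists (Num.max M 1)^-1 => [|w]; first by rewrite invr_gt0 lt_max ltr01 orbT.
  rewrite sub0r modulusN => wM /=.
  case: eqVneq => // w0; apply: MA; rewrite modulusV.
  have M1 : 0 < Num.max M 1 by rewrite lt_max ltr01 orbT.
  apply: (@le_lt_trans _ _ (Num.max M 1)); first by rewrite le_max lexx.
  by rewrite -[ltLHS]invrK ltf_pV2 ?posrE ?invr_gt0 ?modulus_gt0.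
move=> zA.
have cV := cvgC_inv (nbhs_filter (z : C)) z0 cvg_id zA.
have : \forall w \near (z : C), w != 0.
  apply/nbhs_CP; exists (modulus z) => [|w]; first by rewrite modulus_gt0.
  by apply: contraTneq => ->; rewrite subr0 ltxx.
have : \forall w \near (z : C), A (Some w^-1) by exact: cV.
by apply: filterS2 => w Aw w0; rewrite /= (negPf w0).
Qed.

Lemma mobius_affine (a b d : R[i]) : d != 0 ->
  mobius a b 0 d = omap (fun z : C => a / d * z + b / d : C).
Proof.
move=> d0; apply/funext => -[z|] /=; last by rewrite eqxx.
by rewrite mul0r add0r (negPf d0); congr Some; field.
Qed.

(** Division with remainder: (az + b)/(cz + d) = a/c + ((bc - ad)/c)/(cz + d). Continuity of Möbius
    maps thus reduces to affine maps and inversion. *)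
Lemma mobius_decomp (a b c d : R[i]) : c != 0 ->
  mobius a b c d = omap (fun z : C => (b * c - a * d) / c * z + a / c : C) \o
    sphere_inv \o omap (fun z : C => c * z + d : C).
Proof.
move=> c0; apply/funext => -[z|] /=; last by rewrite (negPf c0) mulr0 add0r.
case: eqVneq => //= w0; congr Some; field.
by rewrite w0 c0.
Qed.

Lemma mobius_homeomorphism (f : sphere R -> sphere R) :
  is_mobius f -> homeomorphism f.
Proof.
move=> [a [b [c [d [det0 ->]]]]].
have [c0|c0] := eqVneq c 0.
  move: det0; rewrite c0 mulr0 subr0 mulf_eq0 negb_or => /andP[a0 d0].
  rewrite mobius_affine//; apply: homeomorphism_affine.
  by rewrite mulf_neq0// invr_eq0.
rewrite mobius_decomp//; apply: homeomorphism_comp.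
  exact: homeomorphism_affine.
apply: homeomorphism_comp; first exact: homeomorphism_inv.
by apply: homeomorphism_affine; rewrite mulf_neq0 ?invr_eq0// -opprB oppr_eq0.
Qed.

Lemma conjugate_top_conjugate (f g : sphere R -> sphere R) :
  conjugate f g -> top_conjugate f g.
Proof.
move=> [h [k [Hh hK kK ->]]]; exists h, k; split => //.
exact: mobius_homeomorphism.
Qed.

Lemma dilationE (mu : R[i]) : dilation mu = omap (fun z : C => mu * z : C).
Proof.
rewrite /dilation mobius_affine ?oner_eq0//; congr omap.
by apply/funext => z; rewrite divr1 mul0r addr0.
Qed.

(** Inversion is the conjugating map; this exchanges the cases |mu| < 1 and |mu| > 1. *)
Lemma dilation_inv (mu : R[i]) : mu != 0 ->
  top_conjugate (dilation mu) (dilation mu^-1).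
Proof.
move=> mu0; apply: (top_conjugate_of homeomorphism_inv).
rewrite !dilationE; apply/funext => -[z|] /=; last by rewrite mulr0.
rewrite mulf_eq0 invr_eq0 (negPf mu0) /=.
by case: eqVneq => //= z0; rewrite invfM invrK.
Qed.

Lemma homeomorphism_conj :
  homeomorphism (omap (fun z : C => z^* : C) : sphere R -> sphere R).
Proof.
have cJ : continuous (fun z : C => z^* : C).
  by move=> z; exact: (cvg_conj (nbhs_filter z) cvg_id).
apply: (@homeomorphism_omap _ (fun z : C => z^* : C)) => //; exact: conjcK.
Qed.

(** Complex conjugation is the conjugating map; it accounts for the ambiguity left in part (b). *)
Lemma dilation_conj (mu : R[i]) : top_conjugate (dilation mu) (dilation mu^*).
Proof.
apply: (top_conjugate_of homeomorphism_conj).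
by rewrite !dilationE; apply/funext => -[z|] //=; rewrite rmorphM /= conjcK.
Qed.

End sphere_maps.

(** * Polar coordinates and twists *)

Section complex_exponential.
Context {R : realType}.
Local Notation C := (R[i]^o).
Implicit Types (z w : R[i]) (p q : R * R).

(** The complex exponential, the pair (x, y) standing for x + iy; [R * R] serves as the covering
    plane of the punctured plane. *)
Definition cexp p : R[i] := (expR p.1 * cos p.2) +i* (expR p.1 * sin p.2).

Lemma cexpD p q : cexp (p + q) = cexp p * cexp q.
Proof. by rewrite /cexp /= expRD cosD sinD; simpc; congr (_ +i* _); ring. Qed.

Lemma modulus_cexp p : modulus (cexp p) = expR p.1.
Proof.
apply/eqP; rewrite -(@eqrXn2 _ 2) ?modulus_ge0 ?expR_ge0//; apply/eqP.
by rewrite sqr_modulus /= !exprMn -mulrDr cos2Dsin2 mulr1.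
Qed.

Lemma cexp_neq0 p : cexp p != 0.
Proof. by rewrite -modulus_gt0 modulus_cexp expR_gt0. Qed.

Lemma cexp_eq1 p : cexp p = 1 -> p.1 = 0 /\ cos p.2 = 1.
Proof.
move=> p1; have e1 : expR p.1 = 1 by rewrite -modulus_cexp p1 modulusR normr1.
split; first by apply: expR_inj; rewrite e1 expR0.
by move: p1 => /(congr1 Re) /=; rewrite e1 mul1r.
Qed.

(** [acos] parametrizes the upper half circle; the lower half follows by changing the sign of the
    angle. *)
Lemma unit_circle_angle (a b : R) :
  a ^+ 2 + b ^+ 2 = 1 -> exists y, cos y = a /\ sin y = b.
Proof.
move=> ab1; have a1 : -1 <= a <= 1.
  by rewrite -ler_norml -(@ler_pXn2r _ 2)// ?nnegrE// expr1n real_normK ?num_real//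
    -ab1 lerDl sqr_ge0.
have sE : Num.sqrt (1 - a ^+ 2) = `|b| by rewrite -ab1 addrC addKr sqrtr_sqr.
have [b0|b0] := leP 0 b.
  by exists (acos a); rewrite acosK ?in_itv// sin_acos// sE ger0_norm.
exists (- acos a); rewrite cosN sinN acosK ?in_itv// sin_acos// sE.
by rewrite ltr0_norm// opprK.
Qed.

Lemma cexp_surj z : z != 0 -> exists y, z = cexp (ln (modulus z), y).
Proof.
rewrite -modulus_gt0 => z0.
have [|y [cy sy]] := @unit_circle_angle (Re z / modulus z) (Im z / modulus z).
  by rewrite !exprMn -mulrDl -sqr_modulus -exprMn divff ?gt_eqF// expr1n.
exists y; rewrite /cexp /= lnK ?posrE// cy sy ![modulus z * _]mulrC !divfK ?gt_eqF//.
by case: z {z0 cy sy}.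
Qed.

Lemma cvg_cexp (T : Type) (F : set_system T) (FF : Filter F) (f g : T -> R) (a b : R) :
  f @ F --> a -> g @ F --> b ->
  (cexp (f t, g t) : C) @[t --> F] --> (cexp (a, b) : C).
Proof.
move=> fa gb; apply: cvg_Complex => /=; apply: cvgM.
- exact: continuous_cvg (@continuous_expR R a) fa.
- exact: continuous_cvg (@continuous_cos R b) gb.
- exact: continuous_cvg (@continuous_expR R a) fa.
- exact: continuous_cvg (@continuous_sin R b) gb.
Qed.

(** The map z |z|^(s-1) e^(i t log |z|). At 0 the default value of [ln] is harmless, since the
    factor z vanishes. *)
Definition twist (s t : R) (z : C) : C :=
  z * cexp ((s - 1) * ln (modulus z), t * ln (modulus z)).

Lemma twist0 s t : twist s t 0 = 0.
Proof. exact: mul0r. Qed.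

Lemma twistM s t z w : twist s t (z * w) = twist s t z * twist s t w.
Proof.
have [->|z0] := eqVneq z 0; first by rewrite mul0r twist0 mul0r.
have [->|w0] := eqVneq w 0; first by rewrite mulr0 twist0 mulr0.
rewrite /twist mulrACA -cexpD modulusM lnM ?posrE ?modulus_gt0//.
by rewrite !mulrDr.
Qed.

Lemma modulus_twist s t z :
  z != 0 -> modulus (twist s t z) = expR (s * ln (modulus z)).
Proof.
move=> z0; rewrite modulusM modulus_cexp /= mulrBl mul1r expRD expRN.
by rewrite lnK ?posrE ?modulus_gt0// mulrCA divff ?mulr1// gt_eqF// modulus_gt0.
Qed.

Lemma twist_cexp s t p : twist s t (cexp p) = cexp (s * p.1, p.2 + t * p.1).
Proof.
rewrite /twist modulus_cexp expRK -cexpD; congr cexp.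
by case: p => x y /=; congr (_, _) => /=; ring.
Qed.

(** In logarithmic coordinates a twist is the linear map (x, y) -> (s x, y + t x), with inverse (x,
    y) -> (x/s, y - (t/s) x). *)
Lemma twistK s t : s != 0 -> cancel (twist s t) (twist s^-1 (- (t / s))).
Proof.
move=> s0 z; have [->|z0] := eqVneq z 0; first by rewrite !twist0.
have [y ->] := cexp_surj z0; rewrite !twist_cexp; congr cexp.
by congr (_, _) => /=; field.
Qed.

(** Away from 0 every factor is continuous; at 0 the modulus of the image is |z|^s, which tends to 0
    because s > 0. *)
Lemma twist_continuous s t : 0 < s -> continuous (twist s t).
Proof.
move=> s0 z; have [->|z0] := eqVneq z 0; last first.
  apply: (cvgC_mul (nbhs_filter (z : C))); first exact: cvg_id.
  have lm : ln (modulus w) @[w --> nbhs (z : C)] --> ln (modulus z).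
    have lnz : {for modulus z, continuous (@ln R)}.
      by apply: continuous_ln; rewrite modulus_gt0.
    exact: (cvg_comp _ _ (@continuous_modulus R z) lnz).
  apply: (cvg_cexp (nbhs_filter (z : C))).
    by apply: cvgMr lm.
  by apply: cvgMr lm.
apply/(cvgC_lt (nbhs_filter (0 : C))) => e e0.
(* The radius is e^(1/s), the solution of r^s = e. *)
apply/nbhs_CP; exists (expR (ln e / s)) => [|w]; first exact: expR_gt0.
rewrite twist0 !sub0r !modulusN.
have [->|w0] := eqVneq w 0; first by rewrite twist0 modulusR normr0.
rewrite modulus_twist// -[X in X < _]lnK ?posrE ?modulus_gt0// ltr_expR => wd.
by rewrite -[ltRHS]lnK ?posrE// ltr_expR mulrC -ltr_pdivlMr.
Qed.

Lemma homeomorphism_twist s t : 0 < s ->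
  homeomorphism (omap (twist s t) : sphere R -> sphere R).
Proof.
move=> s0; have s_neq0 : s != 0 by rewrite gt_eqF.
apply: (@homeomorphism_omap _ _ (twist s^-1 (- (t / s)))).
- exact: twistK.
- move=> z; have := @twistK s^-1 (- (t / s)) (invr_neq0 s_neq0) z.
  by rewrite invrK mulNr opprK divfK.
- exact: twist_continuous.
- by apply: twist_continuous; rewrite invr_gt0.
Qed.

Lemma dilation_top_conjugate2 (mu : R[i]) : mu != 0 -> `|mu| != 1 ->
  top_conjugate (dilation mu) (dilation 2).
Proof.
wlog mu1 : mu / 1 < modulus mu => [wl mu0 mu1|mu0 _].
  have [|mu_gt1|muE] := ltgtP (modulus mu) 1; last 1 first.
  - by move: mu1; rewrite normCE muE eqxx.
  - move=> mu_lt1; apply: top_conjugate_trans (dilation_inv mu0) _.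
    apply: wl; rewrite ?invr_eq0//.
      by rewrite modulusV invf_gt1// modulus_gt0.
    by rewrite normfV invr_eq1.
  - exact: wl.
have [y muE] := cexp_surj mu0.
have ln2 : 0 < ln (2 : R) by rewrite ln_gt0// ltr1n.
(* These values solve [twist s t 2 = mu]; |mu| > 1 is what makes [s] positive. Multiplicativity of
   the twist then gives the intertwining relation. *)
pose s := ln (modulus mu) / ln 2; pose t := y / ln 2.
apply: (top_conjugate_of (homeomorphism_twist t (divr_gt0 (ln_gt0 mu1) ln2))).
rewrite !dilationE; apply/funext => -[z|] //=; congr Some.
rewrite twistM; congr (_ * _).
have -> : 2 = cexp (ln 2, 0) :> R[i].
  by rewrite /cexp /= cos0 sin0 mulr0 mulr1 lnK ?posrE// -(rmorph_nat (real_complex R)).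
rewrite twist_cexp [LHS]muE; congr cexp.
by rewrite /s /t /= add0r !divfK ?gt_eqF.
Qed.

End complex_exponential.

(** * Lifting angles *)

Section angle_lifting.
Context {R : realType}.

Definition has_angle (T : topologicalType) (c s : T -> R) :=
  exists A : T -> R, continuous A /\ forall x, cos (A x) = c x /\ sin (A x) = s x.

(** On the open right half circle [asin] recovers the angle continuously from the sine. *)
Lemma has_angle_pos (T : topologicalType) (c s : T -> R) :
  continuous s -> (forall x, 0 < c x) -> (forall x, c x ^+ 2 + s x ^+ 2 = 1) ->
  has_angle c s.
Proof.
move=> cs c0 cs1; exists (asin \o s).
have s1 x : -1 < s x < 1.
  rewrite -ltr_norml -(@ltr_pXn2r _ 2)// ?nnegrE// expr1n real_normK ?num_real//.
  by rewrite -(cs1 x) ltrDr exprn_gt0.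
split=> [x|x] /=.
  by apply: continuous_comp; [exact: cs|exact: continuous_asin].
have /andP[s1l s1r] := s1 x.
rewrite asinK ?in_itv/= ?(ltW s1l) ?(ltW s1r)//; split => //.
rewrite cos_asin ?(ltW s1l) ?(ltW s1r)// -(cs1 x) addrK sqrtr_sqr.
by rewrite gtr0_norm.
Qed.

(** The new pair is the product (c + i s)(c' + i s'), so the angles add. *)
Lemma has_angle_mul (T : topologicalType) (c s c' s' : T -> R) :
  has_angle c s -> has_angle c' s' ->
  has_angle (fun x => c x * c' x - s x * s' x) (fun x => s x * c' x + c x * s' x).
Proof.
move=> [A [cA hA]] [B [cB hB]]; exists (fun x => A x + B x); split.
  by move=> x; apply: cvgD; [exact: cA|exact: cB].
by move=> x; rewrite cosD sinD; have [-> ->] := hA x; have [-> ->] := hB x.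
Qed.

(** The values of f on [0, 1] lie in a discrete set, so the intermediate value theorem forbids any
    change. *)
Lemma cos_eq1_segment (f : R -> R) :
  continuous f -> (forall t, 0 <= t <= 1 -> cos (f t) = 1) -> f 0 = f 1.
Proof.
wlog f01 : f / f 0 <= f 1 => [wl cf f1|cf f1].
  have [|f10] := leP (f 0) (f 1); first by move=> /wl; exact.
  apply: oppr_inj; apply: (wl (fun t => - f t)).
  - by rewrite lerN2 ltW.
  - by move=> t; apply: cvgN; exact: cf.
  - by move=> t t01; rewrite cosN f1.
apply/eqP; rewrite eq_le f01 /= -subr_le0.
(* Capping the increment at pi puts [x] in [0, pi], where cosine is injective; so [cos x = 1] forces
   [x = 0]. *)
pose x := Num.min (f 1 - f 0) pi.
have x0 : 0 <= x by rewrite le_min subr_ge0 f01 pi_ge0.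
have [|t] := @IVT R f 0 1 (f 0 + x) ler01 (continuous_subspaceT cf).
  rewrite min_l// max_r// lerDl x0 /= -lerBrDl.
  by rewrite ge_min lexx.
rewrite in_itv /= => t01 ftx.
have cx : cos x = 1.
  have c0 : cos (f 0) = 1 by rewrite f1// lexx ler01.
  have s0 : sin (f 0) = 0 by apply: cos1sin0; rewrite c0 normr1.
  by have := f1 _ t01; rewrite ftx cosD c0 s0 mul1r mul0r subr0.
have x00 : x = 0.
  apply: cos_inj; rewrite ?in_itv/= ?lexx ?pi_ge0 ?x0 ?cx ?cos0//=.
  by rewrite ge_min lexx orbT.
move: x00; rewrite /x /Num.min; case: ifP => [_ ->//|_ pi0].
by have := pi_gt0 R; rewrite pi0 ltxx.
Qed.

Lemma cvg_pairR (T : Type) (F : set_system T) (FF : Filter F) (f g : T -> R) (a b : R) :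
  f @ F --> a -> g @ F --> b -> ((f t, g t) : R * R) @[t --> F] --> ((a, b) : R * R).
Proof. exact: (cvg_pair (G := nbhs a) (H := nbhs b)). Qed.

(* The angle along a ray is a sum of n increments.  By compactness n can be
   chosen so that each increment stays below pi / 2 in absolute value, where
   [asin] recovers it; clipping to the box makes the increments continuous on
   the whole plane. *)
Lemma has_angle_box (c s : R * R -> R) (M : R) : 0 <= M ->
  continuous c -> continuous s -> (forall p, c p ^+ 2 + s p ^+ 2 = 1) ->
  exists A : R * R -> R, continuous A /\
    forall p, `|p.1| <= M -> `|p.2| <= M -> cos (A p) = c p /\ sin (A p) = s p.
Proof.
move=> M0 cc cs cs1.
(* The expression is the cosine of the angle between the values at p and q, so [P n p] bounds the
   change of angle by a quarter turn. *)
pose P (n : nat) (p : R * R) := forall q : R * R,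
  `|p.1 - q.1| <= M / n.+1%:R -> `|p.2 - q.2| <= M / n.+1%:R ->
  0 < c q * c p + s q * s p.
have [N PN] : exists N, forall p, `|p.1| <= M -> `|p.2| <= M -> P N p.
  have : compact (`[- M, M] `*` `[- M, M] : set (R * R)).
    by apply: compact_setX; exact: segment_compact.
  (* This form of compactness turns a mesh that works near each point into one that works on the
     whole square, like a Lebesgue number. *)
  move=> /compact_near_coveringP/(_ nat \oo P _)[|N _ /(_ N (leqnn N)) hN].
    move=> p _.
    have cp := (cvgrPdist_lt _ _).1 (cc p) (1 / 2) ltac:(lra).
    have sp := (cvgrPdist_lt _ _).1 (cs p) (1 / 2) ltac:(lra).
    have : nbhs p [set q | `|c p - c q| < 1 / 2 /\ `|s p - s q| < 1 / 2].
      by near=> q; split; near: q.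
    move=> /nbhs_ballP[e /= e0 eP].
    have e20 : 0 < e / 2 by rewrite divr_gt0.
    exists (ball p (e / 2), [set n | M / n.+1%:R < e / 2]) => /=.
      split; first exact: nbhsx_ballx.
      near=> n => /=; rewrite ltr_pdivrMr// mulrC -ltr_pdivrMr//.
      apply: (@lt_trans _ _ n%:R); last by rewrite ltr_nat.
      by near: n; exact: nbhs_infty_gtr.
    case=> -[p1 p2] n /= [[/= pp1 pp2] Mn] [q1 q2] /= q1e q2e.
    have [|cp' sp'] := eP (p1, p2).
      by split => /=; [apply: le_ball pp1|apply: le_ball pp2]; lra.
    have [|cq sq] := eP (q1, q2).
      split => /=; rewrite (splitr e).
        apply: (ball_triangle pp1); rewrite -ball_normE /=.
        exact: le_lt_trans q1e Mn.
      apply: (ball_triangle pp2); rewrite -ball_normE /=.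
      exact: le_lt_trans q2e Mn.
    have : `|c (p1, p2) - c (q1, q2)| < 1.
      by have := ler_distD (c p) (c (p1, p2)) (c (q1, q2)); rewrite (distrC _ (c p)); lra.
    have : `|s (p1, p2) - s (q1, q2)| < 1.
      by have := ler_distD (s p) (s (p1, p2)) (s (q1, q2)); rewrite (distrC _ (s p)); lra.
    (* For unit vectors the inner product is 1 minus half the squared distance, and that squared
       distance is below 2 here. *)
    rewrite !ltr_norml; have := cs1 (p1, p2); have := cs1 (q1, q2).
    by move=> u1 u2 /andP[s1 s2] /andP[c1 c2]; nra.
  by exists N => p p1 p2; apply: hN; split => /=; rewrite in_itv/= -ler_norml.
pose n := N.+1; pose cl (x : R) : R := Num.max (- M) (Num.min M x).
have clM x : `|cl x| <= M.
  rewrite ler_norml /cl le_max lexx /= ge_max ge_min lexx /= andbT.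
  by rewrite lerNl (le_trans _ M0)// lerNl oppr0.
have clE x : `|x| <= M -> cl x = x.
  by rewrite ler_norml => /andP[Mx xM]; rewrite /cl min_r// max_r.
have ccl : continuous cl.
  move=> x; have cid : {for x, continuous (id : R -> R^o)} by exact: cvg_id.
  have ccst (a : R) : {for x, continuous ((fun=> a) : R -> R^o)} by exact: cvg_cst.
  exact: (continuous_max (ccst (- M)) (continuous_min (ccst M) cid)).
(* The ray from the origin to the clipped point is cut into [n = N.+1] equal steps, each moving a
   coordinate by at most [M / N.+1%:R], as [P N] requires. *)
pose pt (j : nat) (p : R * R) : R * R := (j%:R / n%:R * cl p.1, j%:R / n%:R * cl p.2).
have cpt j : continuous (pt j).
  have c1 : continuous (fst : R * R -> R) by move=> q; exact: cvg_fst.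
  have c2 : continuous (snd : R * R -> R) by move=> q; exact: cvg_snd.
  have ca : continuous (fun x : R => j%:R / n%:R * cl x).
    by move=> x; apply: cvgM; [exact: cvg_cst|exact: ccl].
  by move=> p; apply: cvg_pairR; [exact: (cvg_comp _ _ (c1 p) (ca _))
    |exact: (cvg_comp _ _ (c2 p) (ca _))].
have ptM j x : (j <= n)%N -> `|j%:R / n%:R * cl x| <= M.
  move=> jn; rewrite normrM -[leRHS]mul1r ler_pM//.
  by rewrite ger0_norm ?divr_ge0// ler_pdivrMr ?ltr0n// mul1r ler_nat.
have step j x : `|j%:R / n%:R * cl x - j.+1%:R / n%:R * cl x| <= M / N.+1%:R.
  have -> : j%:R / n%:R * cl x - j.+1%:R / n%:R * cl x = - (cl x / n%:R).
    by rewrite -natr1; ring.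
  by rewrite normrN normrM (ger0_norm (_ : 0 <= n%:R^-1)) ?invr_ge0// ler_wpM2r ?invr_ge0.
have lift j : (j <= n)%N -> has_angle (c \o pt j) (s \o pt j).
  elim: j => [_|j IHj jn].
    have [y [cy sy]] := unit_circle_angle (cs1 (0, 0)).
    exists (fun=> y); split; first by move=> p; exact: cvg_cst.
    by move=> p; rewrite /= /pt !mul0r.
  (* [C] and [S] are the real and imaginary parts of the value at [pt j.+1 p] divided by the value
     at [pt j p]. *)
  pose C p := c (pt j.+1 p) * c (pt j p) + s (pt j.+1 p) * s (pt j p).
  pose S p := s (pt j.+1 p) * c (pt j p) - c (pt j.+1 p) * s (pt j p).
  have cc' i : continuous (c \o pt i).
    by move=> p; apply: continuous_comp; [exact: cpt|exact: cc].
  have cs' i : continuous (s \o pt i).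
    by move=> p; apply: continuous_comp; [exact: cpt|exact: cs].
  have hw : has_angle C S.
    apply: has_angle_pos.
    - move=> p; apply: cvgB; apply: cvgM; [exact: cs'|exact: cc'|exact: cc'|exact: cs'].
    - move=> p; apply: PN; rewrite /pt/= ?ptM//; [exact: ltnW|exact: ltnW].
    - move=> p; rewrite /C /S; have := cs1 (pt j p); have := cs1 (pt j.+1 p).
      set a := c _; set b := s _; set a' := c _; set b' := s _ => ab ab'.
      transitivity ((a ^+ 2 + b ^+ 2) * (a' ^+ 2 + b' ^+ 2)); first by ring.
      by rewrite ab ab' mulr1.
  have [A [cA hA]] := has_angle_mul (IHj (ltnW jn)) hw.
  exists A; split => // p; have [-> ->] := hA p; rewrite /C /S /=.
  have := cs1 (pt j p).
  set a' := c (pt j.+1 p); set b' := s (pt j.+1 p).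
  set a := c _; set b := s _ => ab.
  split; [transitivity (a' * (a ^+ 2 + b ^+ 2))|transitivity (b' * (a ^+ 2 + b ^+ 2))];
    by [ring|rewrite ab mulr1].
have [A [cA hA]] := lift n (leqnn n); exists A; split => // p p1 p2.
have [-> ->] := hA p; rewrite /= /pt divff ?pnatr_eq0// !mul1r !clE//.
by case: p {p1 p2}.
Unshelve. all: by end_near. Qed.

(** Lifts on growing boxes are normalized to agree at the origin. They then agree on overlaps and
    glue to a lift on the plane. *)
Lemma angle_lift (c s : R * R -> R) :
  continuous c -> continuous s -> (forall p, c p ^+ 2 + s p ^+ 2 = 1) ->
  has_angle c s.
Proof.
move=> cc cs cs1.
have [y [cy sy]] := unit_circle_angle (cs1 (0, 0)).
pose box (m : nat) (p : R * R) := `|p.1| <= m%:R /\ `|p.2| <= m%:R.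
have /choice[A hA] : forall m : nat, exists A : R * R -> R, [/\ continuous A,
    A (0, 0) = y & forall p, box m p -> cos (A p) = c p /\ sin (A p) = s p].
  move=> m; have [A [cA hA]] := has_angle_box (ler0n R m) cc cs cs1.
  have [||c0 s0] := hA (0, 0); rewrite ?normr0 ?ler0n//.
  exists (fun p => A p + (y - A (0, 0))); split.
  - by move=> p; apply: cvgD; [exact: cA|exact: cvg_cst].
  - by rewrite subrKC.
  - move=> p [p1 p2]; have [cp sp] := hA p p1 p2.
    have cd : cos (y - A (0, 0)) = 1.
      by rewrite cosB cy sy c0 s0 -!expr2 cs1.
    have sd : sin (y - A (0, 0)) = 0 by apply: cos1sin0; rewrite cd normr1.
    by rewrite (cosD (A p)) (sinD (A p)) cd sd !mulr1 !mulr0 subr0 addr0.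
have agree m m' p : (m <= m')%N -> box m p -> A m p = A m' p.
  (* Along the ray to p the difference of two lifts has cosine 1, so it keeps its value 0 from the
     origin. *)
  move=> mm' mp; pose f t := A m (t * p.1, t * p.2) - A m' (t * p.1, t * p.2).
  have [cA A0 mA] := hA m; have [cA' A0' mA'] := hA m'.
  have cray : continuous (fun t : R => (t * p.1, t * p.2) : R * R).
    have cM a : continuous (fun t : R => t * a).
      by move=> t; apply: cvgM; [exact: cvg_id|exact: cvg_cst].
    by move=> t; apply: cvg_pairR; exact: cM.
  have /(@cos_eq1_segment f) : continuous f.
    move=> t; apply: cvgB.
      exact: (cvg_comp _ _ (cray t) (cA _)).
    exact: (cvg_comp _ _ (cray t) (cA' _)).
  rewrite /f !mul0r !mul1r A0 A0' subrr -!surjective_pairing => f01.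
  apply/esym/eqP; rewrite -subr_eq0 -opprB oppr_eq0 eq_sym; apply/eqP/f01 => t /andP[t0 t1].
  have tp : box m (t * p.1, t * p.2).
    by case: mp => p1 p2; split=> /=; rewrite normrM (ger0_norm t0) -[leRHS]mul1r ler_pM.
  have tp' : box m' (t * p.1, t * p.2).
    by case: tp => p1 p2; split; rewrite (le_trans p1, le_trans p2)// ler_nat.
  by rewrite cosB; have [-> ->] := mA _ tp; have [-> ->] := mA' _ tp'; rewrite -!expr2 cs1.
(* The strict bound places p in the interior of its box, so near p the glued angle coincides with
   the single lift [A (ind p)]. *)
pose ind (p : R * R) := (Num.truncn (Num.max `|p.1| `|p.2|)).+1.
have indP p : Num.max `|p.1| `|p.2| < (ind p)%:R.
  by rewrite /ind truncnS_gt.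
have ind_box p : box (ind p) p.
  by have := indP p; rewrite gt_max => /andP[/ltW ? /ltW ?].
have AE m p : box m p -> A (ind p) p = A m p.
  move=> mp; have [le|/ltnW le] := leqP m (ind p); last exact: agree.
  by rewrite (agree _ _ _ le).
exists (fun p => A (ind p) p); split=> [p|p]; last first.
  by have [_ _] := hA (ind p); apply.
have [cA _ _] := hA (ind p).
apply: cvg_trans (cA p); apply: near_eq_cvg.
have := indP p; rewrite gt_max => /andP[p1 p2].
near=> q; rewrite /= (@AE (ind p))//; split; apply: ltW; near: q.
- have cn : `|q.1| @[q --> p] --> `|p.1| by apply: cvg_norm; exact: cvg_fst.
  exact: (cvgr_lt _ cn _ p1).
- have cn : `|q.2| @[q --> p] --> `|p.2| by apply: cvg_norm; exact: cvg_snd.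
  exact: (cvgr_lt _ cn _ p2).
Unshelve. all: by end_near. Qed.

End angle_lifting.

(** * Conjugacy of rotations *)

Section covering_degree.
Context {R : realType}.
Local Notation C := (R[i]^o).
Implicit Types (p q : R * R).

Lemma continuous_shift (v : R * R) : continuous (fun p => p + v).
Proof. by move=> p; apply: cvgD; [exact: cvg_id|exact: cvg_cst]. Qed.

Lemma continuous_cexp : continuous (cexp : R * R -> C).
Proof.
move=> p; have -> : (cexp : R * R -> C) = fun q => cexp (q.1, q.2).
  by apply/funext => -[].
by apply: cvg_cexp; [exact: cvg_fst|exact: cvg_snd].
Qed.

Lemma cos_eq1_const (G : R * R -> R) :
  continuous G -> (forall p, cos (G p) = 1) -> forall p q, G p = G q.
Proof.
move=> cG G1; suff G0 p : G (0, 0) = G p by move=> p q; rewrite -!G0.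
have := @cos_eq1_segment R (fun t => G (t * p.1, t * p.2)).
rewrite !mul0r !mul1r -surjective_pairing; apply => // t.
have cM a : continuous (fun t : R => t * a).
  by move=> x; apply: cvgM; [exact: cvg_id|exact: cvg_cst].
have ct : {for t, continuous (fun t : R => (t * p.1, t * p.2) : R * R)}.
  by apply: cvg_pairR; exact: cM.
exact: (cvg_comp _ _ ct (cG _)).
Qed.

(** Reduce x modulo 2 pi to r in [0, 2 pi). Injectivity of cosine on [0, pi] is applied to r, or to
    2 pi - r when r > pi. *)
Lemma cos_eq1_2pi (x : R) : cos x = 1 -> exists d : int, x = d%:~R * (2 * pi).
Proof.
have pi0 := pi_gt0 R; have pi20 : 0 < 2 * pi :> R by rewrite mulr_gt0.
have cosper (n : int) y : cos (y + n%:~R * (2 * pi)) = cos y :> R.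
  have nat_per (m : nat) z : cos (z + m%:R * (2 * pi)) = cos z :> R.
    rewrite -(periodicn (@cosD2pi R) m z); congr (cos (_ + _)).
    by rewrite !mulr_natl.
  case: n => m; first exact: nat_per.
  by rewrite NegzE mulrNz mulNr -(nat_per m.+1 (y - _)) subrK.
move=> cx; pose d := Num.floor (x / (2 * pi)); exists d.
have /andP[dl du] := floor_itv (x / (2 * pi)).
have := cosper (- d) x; rewrite cx mulrNz mulNr.
set r := x - _ => cr; apply/eqP; rewrite -subr_eq0 -/r.
have r0 : 0 <= r by rewrite subr_ge0 -ler_pdivlMr.
have r2 : r < 2 * pi.
  by rewrite ltrBlDl -[X in _ + X]mul1r -mulrDl -ltr_pdivrMr// -intrD1.
apply/eqP; have [rpi|pir] := leP r pi.
  by apply: cos_inj; rewrite ?in_itv/= ?lexx ?pi_ge0 ?r0 ?cr ?cos0.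
suff : 2 * pi - r = 0 by lra.
apply: cos_inj; rewrite ?in_itv/= ?lexx ?pi_ge0//.
  by apply/andP; split; lra.
by rewrite cos0 -[RHS]cr -(cosper (-1) r) mulrN1z mulN1r -[RHS]cosN [in RHS]opprB.
Qed.

(** The difference of two lifts takes values in the discrete kernel of the exponential, hence is
    constant. This turns identities between maps of the plane into additive identities between
    lifts. *)
Lemma exp_lifts_deck (H H' : R * R -> R * R) : continuous H -> continuous H' ->
  (forall p, cexp (H p) = cexp (H' p)) ->
  exists c, cos c = 1 /\ forall p, H p = H' p + (0, c).
Proof.
move=> cH cH' HH'.
have H1 p : (H p).1 = (H' p).1.
  by apply: expR_inj; rewrite -!modulus_cexp HH'.
have cG : continuous (fun p => (H p).2 - (H' p).2).
  have c2 : continuous (snd : R * R -> R) by move=> q; exact: cvg_snd.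
  move=> p; apply: cvgB.
    exact: (cvg_comp _ _ (cH p) (c2 _)).
  exact: (cvg_comp _ _ (cH' p) (c2 _)).
have G1 p : cos ((H p).2 - (H' p).2) = 1.
  have : cexp (H p - H' p) = 1.
    by apply: (mulIf (cexp_neq0 (H' p))); rewrite -cexpD subrK HH' mul1r.
  by case/cexp_eq1.
exists ((H (0, 0)).2 - (H' (0, 0)).2); split=> // p.
rewrite (cos_eq1_const cG G1 (0, 0) p); have := H1 p.
case: (H p) (H' p) => [a b] [a' b'] /= ->; congr (_, _) => /=.
  by rewrite addr0.
by rewrite subrKC.
Qed.

(** The real part of the lift is the logarithm of the modulus; the imaginary part is an angle
    supplied by [angle_lift]. *)
Lemma exp_lift (g : C -> C) : continuous g -> (forall z, z != 0 -> g z != 0) ->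
  exists H : R * R -> R * R, continuous H /\ forall p, cexp (H p) = g (cexp p).
Proof.
move=> cg g0; pose G p : C := g (cexp p).
have cG : continuous G.
  by move=> p; apply: (cvg_comp _ _ (@continuous_cexp p)); exact: cg.
have mG p : 0 < modulus (G p) by rewrite modulus_gt0 g0// cexp_neq0.
have cm : continuous (fun p => modulus (G p)).
  by move=> p; apply: cvg_modulus; exact: cG.
have ciV : continuous (fun p => (modulus (G p))^-1).
  by move=> p; apply: cvgV; [rewrite gt_eqF|exact: cm].
have [|||A [cA hA]] := @angle_lift R (fun p => Re (G p) / modulus (G p))
    (fun p => Im (G p) / modulus (G p)).
- by move=> p; apply: cvgM; [apply: cvg_Re; exact: cG|exact: ciV].
- by move=> p; apply: cvgM; [apply: cvg_Im; exact: cG|exact: ciV].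
- by move=> p; rewrite !exprMn -mulrDl -sqr_modulus -exprMn divff ?gt_eqF// expr1n.
exists (fun p => (ln (modulus (G p)), A p)); split=> p.
  apply: cvg_pairR; last exact: cA.
  exact: (cvg_comp _ _ (cm p) (continuous_ln (mG p))).
rewrite /cexp /= lnK ?posrE//; have [-> ->] := hA p.
rewrite ![modulus _ * _]mulrC !divfK ?gt_eqF//.
by rewrite -/(G p); case: (G p).
Qed.

(** By periodicity D attains a global maximum and minimum on [0, T]. Translating by [th] from the
    maximum gives delta <= 0, and from the minimum delta >= 0. *)
Lemma periodic_drift (D : R -> R) (T th delta : R) : 0 < T -> continuous D ->
  (forall y, D (y + T) = D y) -> (forall y, D (y + th) = D y + delta) ->
  delta = 0.
Proof.
move=> T0 cD DT Dth.
have red y : exists2 x, x \in `[0, T] & D y = D x.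
  have DTn (n : nat) x : D (x + n%:R * T) = D x.
    by elim: n x => [|n IH] x; rewrite ?mul0r ?addr0// -natr1 mulrDl mul1r addrA DT.
  have DTz (n : int) x : D (x + n%:~R * T) = D x.
    case: n => m; first exact: DTn.
    by rewrite NegzE mulrNz mulNr -(DTn m.+1 (x - _)) subrK.
  have /andP[dl du] := floor_itv (y / T).
  exists (y + (- Num.floor (y / T))%:~R * T); last by rewrite DTz.
  rewrite mulrNz mulNr in_itv/= subr_ge0 -ler_pdivlMr// dl /=.
  by rewrite lerBlDl -[X in _ + X]mul1r -mulrDl -ler_pdivrMr// -intrD1 ltW.
have cw := @continuous_subspaceT _ _ `[0, T] _ cD.
have [a _ maxa] := EVT_max (ltW T0) cw.
have [b _ minb] := EVT_min (ltW T0) cw.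
apply/eqP; rewrite eq_le; apply/andP; split.
  have [x xT Dx] := red (a + th); have := maxa _ xT.
  by rewrite -Dx Dth gerDl.
have [x xT Dx] := red (b + th); have := minb _ xT.
by rewrite -Dx Dth lerDl.
Qed.

Lemma plane_rotation_conjugacy (h k : C -> C) (mu nu : R[i]) :
  continuous h -> continuous k -> cancel h k -> cancel k h -> h 0 = 0 ->
  modulus mu = 1 -> modulus nu = 1 -> (forall z, h (mu * z) = nu * h z) ->
  nu = mu \/ nu = mu^*.
Proof.
move=> ch ck hK kK h0 mu1 nu1 hmu.
have k0 : k 0 = 0 by rewrite -h0 hK.
have hn0 z : z != 0 -> h z != 0 by move=> z0; rewrite -h0 (can_eq hK).
have kn0 z : z != 0 -> k z != 0 by move=> z0; rewrite -k0 (can_eq kK).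
have [H [cH HE]] := exp_lift ch hn0.
have [K [cK KE]] := exp_lift ck kn0.
pose P : R * R := (0, 2 * pi).
have cexpP p : cexp (p + P) = cexp p.
  by rewrite cexpD [cexp P]/cexp /= expR0 !mul1r !mulr_natl cos2pi sin2pi mulr1.
have cshift (G : R * R -> R * R) v : continuous G -> continuous (fun p => G (p + v)).
  have cv : continuous (fun p => p + v) by exact: continuous_shift.
  by move=> cG p; exact: (cvg_comp _ _ (cv p) (cG _)).
have cadd (G : R * R -> R * R) v : continuous G -> continuous (fun p => G p + v).
  have cv : continuous (fun p => p + v) by exact: continuous_shift.
  by move=> cG p; exact: (cvg_comp _ _ (cG p) (cv _)).
have [c [c1 HP]] : exists c, cos c = 1 /\ forall p, H (p + P) = H p + (0, c).
  by apply: exp_lifts_deck => //; [exact: cshift|move=> p; rewrite !HE cexpP].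
have [e [e1 KP]] : exists e, cos e = 1 /\ forall p, K (p + P) = K p + (0, e).
  by apply: exp_lifts_deck => //; [exact: cshift|move=> p; rewrite !KE cexpP].
have [m [_ KH]] : exists m, cos m = 1 /\ forall p, K (H p) = p + (0, m).
  apply: (@exp_lifts_deck _ id) => [|p|p].
  - by move=> p; exact: (cvg_comp _ _ (cH p) (cK _)).
  - exact: cvg_id.
  - by rewrite KE HE hK.
(* [d] and [d'] are the degrees of [h] and [k] around the origin. *)
have [d cE] := cos_eq1_2pi c1; have [d' eE] := cos_eq1_2pi e1.
have Kn (n : nat) p : K (p + (0, n%:R * (2 * pi))) = K p + (0, n%:R * e).
  elim: n p => [|n IH] p.
    by rewrite !mul0r !addr0.
  have -> : p + (0, n.+1%:R * (2 * pi)) = p + (0, n%:R * (2 * pi)) + P.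
    by rewrite -addrA; congr (_ + _); congr (_, _) => /=; rewrite ?addr0// -natr1; ring.
  rewrite KP IH -addrA; congr (_ + _); congr (_, _) => /=; rewrite ?addr0// -natr1.
  by rewrite mulrDl mul1r.
have Kz (n : int) p : K (p + (0, n%:~R * (2 * pi))) = K p + (0, n%:~R * e).
  case: n => n; first exact: Kn.
  rewrite NegzE; set v : R * R := (0, _).
  have -> : K p = K (p + v) + (0, n.+1%:R * e).
    rewrite -Kn -addrA /v; congr K; rewrite -[LHS]addr0; congr (_ + _).
    by congr (_, _) => /=; rewrite ?addr0// mulrNz mulNr addNr.
  rewrite -addrA -[LHS]addr0; congr (_ + _).
  by congr (_, _) => /=; rewrite ?addr0// mulrNz mulNr subrr.
(* Evaluate K(H(P)) twice: as P + (0, m), and through the translation rules as (0, m) + (0, d e).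
   Hence d e = 2 pi, where e = 2 pi d'. *)
have dd' : d * d' = 1.
  have := KH P; rewrite -[X in H X]add0r HP cE Kz KH.
  move=> /(congr1 snd) /=; rewrite add0r eE => E.
  have : (d * d')%:~R * (2 * pi) = 1 * (2 * pi) :> R.
    by rewrite intrM -mulrA mul1r; lra.
  by move/(mulIf _) => /(_ ltac:(by rewrite mulf_neq0// ?pnatr_eq0// gt_eqF ?pi_gt0)) /eqP;
    rewrite -[1]/(1%:~R) eqr_int => /eqP.
have d1 : d = 1 \/ d = -1.
  have : d \is a GRing.unit by apply/unitrPr; exists d'.
  by rewrite qualifE /= => /orP[] /eqP ->; [left|right].
have mu0 : mu != 0 by rewrite -modulus_gt0 mu1.
have nu0 : nu != 0 by rewrite -modulus_gt0 nu1.
have [th muE] := cexp_surj mu0; have [ph nuE] := cexp_surj nu0.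
rewrite mu1 ln1 in muE; rewrite nu1 ln1 in nuE.
(* The angle [ph] of nu is arbitrary modulo 2 pi; [c'] is the correction that makes it match the
   lift. *)
have [c' [c'1 Hth]] : exists c', cos c' = 1 /\
    forall p, H (p + (0, th)) = H p + (0, ph) + (0, c').
  apply: exp_lifts_deck; [exact: cshift|exact: cadd|move=> p].
  by rewrite HE !cexpD HE -muE -nuE mulrC hmu mulrC.
have s'0 : sin c' = 0 by apply: cos1sin0; rewrite c'1 normr1.
have delta0 : ph + c' - d%:~R * th = 0.
  (* Subtracting the linear growth d y leaves a function of period 2 pi; translation by [th] adds ph
     + c' - d th to it. *)
  apply: (@periodic_drift (fun y => (H (0, y)).2 - d%:~R * y) (2 * pi) th).
  - by rewrite mulr_gt0// pi_gt0.
  - have c2 : continuous (snd : R * R -> R) by move=> q; exact: cvg_snd.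
    have c3 : continuous (fun y : R => (0, y) : R * R).
      by move=> y; apply: cvg_pairR; [exact: cvg_cst|exact: cvg_id].
    move=> y; apply: cvgB; last by apply: cvgM; [exact: cvg_cst|exact: cvg_id].
    exact: (cvg_comp _ _ (c3 y) (cvg_comp _ _ (cH _) (c2 _))).
  - move=> y; have -> : (0, y + 2 * pi) = (0, y) + P.
      by congr (_, _); rewrite /= addr0.
    by rewrite HP cE /=; ring.
  - move=> y; have -> : (0, y + th) = (0, y) + (0, th) :> R * R.
      by congr (_, _); rewrite /= addr0.
    by rewrite Hth /=; ring.
have nuE' : nu = cexp (0, d%:~R * th).
  have -> : (0, d%:~R * th) = (0, ph) + (0, c') :> R * R.
    by congr (_, _); rewrite /= ?addr0//; lra.
  by rewrite cexpD -nuE /cexp /= expR0 c'1 s'0 !mul1r mulr1.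
rewrite nuE' muE; case: d1 => ->; [left|right].
  by rewrite mul1r.
by rewrite mulrN1z mulN1r /cexp /= cosN sinN mulrN.
Qed.

Lemma dilation_fixed (mu : R[i]) (z : sphere R) :
  mu != 1 -> dilation mu z = z -> z = None \/ z = Some 0.
Proof.
rewrite dilationE; case: z => [z|] mu1 /=; last by left.
move=> [muz]; right; congr Some; apply/eqP.
have : (mu - 1) * z == 0 by rewrite mulrBl mul1r muz subrr.
by rewrite mulf_eq0 subr_eq0 (negPf mu1).
Qed.

Lemma fixing_rotation_conjugacy (h : sphere R -> sphere R) (mu nu : R[i]) :
  homeomorphism h -> h None = None -> h (Some 0) = Some 0 ->
  modulus mu = 1 -> modulus nu = 1 ->
  h \o dilation mu = dilation nu \o h -> nu = mu \/ nu = mu^*.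
Proof.
move=> [k [hK kK ch ck]] hN h0 mu1 nu1; rewrite !dilationE => hmu.
(* The default 0 is never reached: an injective f fixing infinity sends finite points to finite
   points. *)
pose fin (f : sphere R -> sphere R) (z : C) : C := odflt 0 (f (Some z)).
have finE (f g : sphere R -> sphere R) z : cancel f g -> f None = None ->
    Some (fin f z) = f (Some z).
  move=> fK fN; rewrite /fin; case E: (f (Some z)) => [//|].
  by have := fK (Some z); rewrite E -fN fK.
have cfin (f g : sphere R -> sphere R) :
    cancel f g -> f None = None -> continuous f -> continuous (fin f).
  move=> fK fN cf z A zA.
  have : nbhs (f (Some z)) (Some @` A).
    by rewrite -(finE f g)//; exact: one_point_compactification_some_nbhs.
  move=> /cf; apply: (@filterS C (nbhs z)) => w [a Aa].
  by rewrite /preimage /= -[X in _ = X](finE f g)// => -[<-].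
have kN : k None = None by rewrite -hN hK.
have k0 : k (Some 0) = Some 0 by rewrite -h0 hK.
apply: (@plane_rotation_conjugacy (fin h) (fin k)) => //.
- exact: cfin hK hN ch.
- exact: cfin kK kN ck.
- by move=> z; have [] : Some (fin k (fin h z)) = Some z
    by rewrite (finE _ _ _ kK)// (finE _ _ _ hK).
- by move=> z; have [] : Some (fin h (fin k z)) = Some z
    by rewrite (finE _ _ _ hK)// (finE _ _ _ kK).
- by rewrite /fin h0.
- move=> z; have := congr1 (fun f => f (Some z)) hmu => /=.
  by rewrite -!(finE _ _ _ hK hN) /= => -[].
Qed.

(** A conjugacy carries the fixed points 0 and infinity of one rotation to those of the other. If it
    swaps them, composing with inversion restores them and replaces nu by its inverse, which is its
    conjugate. *)
Lemma rotation_conjugacy (mu nu : R[i]) :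
  modulus mu = 1 -> modulus nu = 1 -> mu != 1 ->
  top_conjugate (dilation mu) (dilation nu) -> nu = mu \/ nu = mu^*.
Proof.
move=> mu1 nu1 mu_neq1.
move=> /top_conjugate_sym[h [k [Hh hK kK E]]].
have mu0 : mu != 0 by rewrite -modulus_gt0 mu1.
have hE : h \o dilation mu = dilation nu \o h.
  by apply/funext => z; rewrite E /= kK.
(* A conjugate of the identity is the identity; evaluating at 1 would give mu = 1. *)
have nu_neq1 : nu != 1.
  apply: contra_neq mu_neq1 => nuE.
  have := congr1 (fun f => f (Some 1)) E; rewrite nuE !dilationE /= => Ek.
  have : omap (fun z : C => 1 * z : C) (h (Some 1)) = h (Some 1).
    by case: (h _) => //= z; rewrite mul1r.
  by move: Ek => /[swap] ->; rewrite hK mulr1 => -[].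
have fixh z : dilation mu z = z -> h z = None \/ h z = Some 0.
  move=> muz; apply: (@dilation_fixed nu) => //.
  by have := congr1 (fun f => f z) hE; rewrite /= muz.
have hinj := can_inj hK.
have hN : h None = None \/ h None = Some 0 by apply: fixh; rewrite dilationE.
have h0 : h (Some 0) = None \/ h (Some 0) = Some 0.
  by apply: fixh; rewrite dilationE /= mulr0.
case: hN => hN.
  apply: (@fixing_rotation_conjugacy h) => //.
  by case: h0 => // h0; have := hinj _ _ (etrans hN (esym h0)).
have {}h0 : h (Some 0) = None.
  by case: h0 => // h0; have := hinj _ _ (etrans hN (esym h0)).
have nu0 : nu != 0 by rewrite -modulus_gt0 nu1.
have nuV : nu^-1 = nu^* by rewrite invc_norm normCE nu1 expr1n invr1 mul1r.
have : nu^-1 = mu \/ nu^-1 = mu^*.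
  apply: (@fixing_rotation_conjugacy (sphere_inv \o h)) => //.
  - exact: homeomorphism_comp Hh homeomorphism_inv.
  - by rewrite /= hN /= eqxx.
  - by rewrite /= h0.
  - by rewrite modulusV nu1 invr1.
  - rewrite -compA hE; apply/funext => z /=; rewrite !dilationE.
    case: (h z) => [w|] /=; last by rewrite mulr0.
    rewrite mulf_eq0 (negPf nu0) /=.
    by case: eqVneq => //= w0; rewrite invfM.
by rewrite nuV => -[]/(congr1 (@conjc R)); rewrite conjcK ?conjcK; [right|left].
Qed.

End covering_degree.

Theorem corollary1p1 (R : realType) :
  [/\ (forall f : sphere R -> sphere R,
         hyperbolic f \/ loxodromic f -> top_conjugate f (dilation 2)),
      (forall f : sphere R -> sphere R,
         elliptic f ->
         exists mu : R[i],
           [/\ `|mu| = 1,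
               top_conjugate f (dilation mu) &
               forall nu : R[i],
                 `|nu| = 1 ->
                 (top_conjugate f (dilation nu) <-> nu = mu \/ nu = mu^*)])
    & (forall f : sphere R -> sphere R,
         parabolic f -> top_conjugate f (@unit_translation R))].
Proof.
split=> [f|f [_ [mu [mu1 mu_neq1 /conjugate_top_conjugate fmu]]]|f [_ fT]].
- case=> [[_ [mu [_ mu0 mu1 fmu]]]|[_ [mu [muR mu1 fmu]]]].
    apply: top_conjugate_trans (conjugate_top_conjugate fmu) _.
    exact: dilation_top_conjugate2.
  apply: top_conjugate_trans (conjugate_top_conjugate fmu) _.
  apply: dilation_top_conjugate2 => //.
  (* A non-real multiplier is in particular nonzero. *)
  by apply: contraNneq muR => ->; exact: real0.
- exists mu; split => // nu nu1; split => [fnu|[|] ->//].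
    apply: rotation_conjugacy => //.
    + by apply: complexI; rewrite modulusE.
    + by apply: complexI; rewrite modulusE.
    + exact: top_conjugate_trans (top_conjugate_sym fmu) fnu.
  exact: top_conjugate_trans fmu (dilation_conj mu).
- exact: conjugate_top_conjugate.
Qed.
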